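(* Let $(X,\|\cdot\|)$ be an infinite-dimensional Fréchet space and let $\mathcal{V}=\{V_n\}_{n\in\mathbb{N}}$ be a nested sequence of linear subspaces of $X$ such that $\overline{V_n}\subseteq V_{n+1}$ for every $n\in\mathbb{N}$ and $X=\overline{\bigcup_{n=1}^{\infty}V_n}$. Let $\{e_n\}_{n\in\mathbb{N}}$ be a decreasing sequence of positive numbers tending to $0$. Assume that $d_{\mathcal{V}}=\inf\{d_{n,\mathcal{V}}: n\in\mathbb{N}\}>0$. Then there exist $x\in X$ and $n_o\in\mathbb{N}$ such that $\rho_n(x)\geq e_n$ for every $n\geq n_o$.
   Context: $\mathbb{N}=\{1,2,\dots\}$. A Fréchet space $(X,\|\cdot\|)$ is a (real or complex) metric linear space which is complete with respect to an F-norm $\|\cdot\|$ giving its topology; an F-norm satisfies $\|x\|=0$ iff $x=0$, $\|\alpha x\|=\|x\|$ for all scalars with $|\alpha|=1$, and $\|x+y\|\leq\|x\|+\|y\|$ (no local convexity is assumed; scalar multiplication is continuous). Closures are taken with respect to $\|\cdot\|$. For $x\in X$, $\rho_n(x)=\mathrm{dist}(x,V_n)=\inf\{\|x-v\|:v\in V_n\}$, and $d_{n,\mathcal{V}}=\sup\{\rho_n(v):v\in V_{n+1}\}\in[0,\infty]$. *)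

(* Defs.v *)
From HB Require Import structures.
From mathcomp Require Import all_boot all_order all_algebra.
From mathcomp Require Import complex.
From mathcomp Require Import all_classical all_reals all_analysis.

Set Implicit Arguments.
Unset Strict Implicit.
Unset Printing Implicit Defensive.

Import Order.TTheory GRing.Theory Num.Theory.
Import numFieldNormedType.Exports.

Local Open Scope classical_set_scope.
Local Open Scope ring_scope.

Variant scalar_kind := RealScalars | ComplexScalars.

Definition scalar_field (R : realType) (k : scalar_kind) : numFieldType :=
  match k with
  | RealScalars => R
  | ComplexScalars => complex R
  end.

(* Nonnegativity is not listed: 0 = N (x - x) <= N x + N (- x) = N x + N x.
   An F-norm is not homogeneous, so it is not a normedZmodType norm. *)
Record Fnorm (R : realType) (K : numFieldType) (X : lmodType K)
    (N : X -> R) : Prop := {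
  Fnorm_eq0 : forall x, N x = 0 <-> x = 0 ;
  Fnorm_unimodular : forall (a : K) x, `|a| = 1 -> N (a *: x) = N x ;
  Fnorm_triangle : forall x y, N (x + y) <= N x + N y }.

(* Continuity of addition and of scalar multiplication is part of
   topologicalLmodType (which, unlike tvsType, is not locally convex). *)
Record frechet (R : realType) (K : numFieldType) (X : topologicalLmodType K)
    (N : X -> R) : Prop := {
  frechet_Fnorm : Fnorm N ;
  frechet_nbhs : forall x : X,
    nbhs x = filter_from [set r : R | 0 < r]
               (fun r => [set y : X | N (y - x) < r]) ;
  frechet_complete : forall u : nat -> X,
    (forall r : R, 0 < r -> exists n0 : nat, forall m n : nat,
       (n0 <= m)%N -> (n0 <= n)%N -> N (u m - u n) < r) ->
    exists x : X, u @ \oo --> x }.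

Definition infinite_dimensional (K : numFieldType) (X : lmodType K) : Prop :=
  ~ exists (n : nat) (b : 'I_n -> X),
      forall x : X, exists c : 'I_n -> K, x = \sum_(i < n) c i *: b i.

(* The infimum is over a nonempty set bounded below by 0 when N is an F-norm
   and V is a subspace, so the total operator inf is the genuine infimum. *)
Definition rho (R : realType) (K : numFieldType) (X : lmodType K)
    (N : X -> R) (V : nat -> set X) (n : nat) (x : X) : R :=
  inf [set N (x - v) | v in V n].

Definition dn (R : realType) (K : numFieldType) (X : lmodType K)
    (N : X -> R) (V : nat -> set X) (n : nat) : \bar R :=
  ereal_sup [set (rho N V n v)%:E | v in V n.+1].

Definition dV (R : realType) (K : numFieldType) (X : lmodType K)
    (N : X -> R) (V : nat -> set X) : \bar R :=
  ereal_inf (range (dn N V)).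

(* Main.v *)
Require Import Defs.
From mathcomp Require Import all_boot all_order all_algebra.
From mathcomp Require Import complex.
From mathcomp Require Import all_classical all_reals all_analysis.
From mathcomp Require Import lra.

(** The hypothesis [0 < dV N V] gives, for one real [a > 0] and every [m], a
    vector of [V m.+1] at distance more than [a] from [V m].  An F-norm is not
    homogeneous, so this vector cannot be normalised; but its multiples run
    from distance [0] to distance more than [a] from [V m] along a continuous
    path, hence every smaller positive distance is nearly attained, and
    subtracting a near-best approximant from [V m] makes the norm comparable to
    the distance.  Consequently, for every [0 < b <= a], every [V m.+1] has a
    vector [q] with [b <= rho N V m q] and [N q <= 3 * b]
    ([subspaces_have_spread_vectors]).

    The crucial feature is that [b] does not depend on [m].  One can therefore
    fix the sizes [b k = a / 7 ^ k] first, wait for an index [t k] from which on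
    [e <= b k / 2], and only then choose [q k] in [V (t k.+1)] at distance at
    least [b k] from the preceding subspace.  The sum [x] of the [q k] answers
    the question: modulo [V (t k.+1).-1] the terms before [q k] vanish, and the
    terms after it have total norm at most [b k / 2], so that [x] has distance
    at least [b k / 2] from each [V n] with [t k <= n < t k.+1]
    ([rho_lacunary_series]). *)

Set Implicit Arguments.
Unset Strict Implicit.
Unset Printing Implicit Defensive.

Import Order.TTheory GRing.Theory Num.Theory.
Import numFieldNormedType.Exports.

Local Open Scope classical_set_scope.
Local Open Scope ring_scope.

(** * F-norms and distances to subspaces *)

Section FNorm.
Context {R : realType} {K : numFieldType} {X : lmodType K} {N : X -> R}.
Hypothesis hN : Fnorm N.

Lemma Fnorm0 : N 0 = 0.
Proof. by apply/(Fnorm_eq0 hN). Qed.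

Lemma FnormN x : N (- x) = N x.
Proof. by rewrite -scaleN1r (Fnorm_unimodular hN)// normrN1. Qed.

Lemma FnormB x y : N (x - y) = N (y - x).
Proof. by rewrite -opprB FnormN. Qed.

Lemma Fnorm_ge0 x : 0 <= N x.
Proof.
have := Fnorm_triangle hN x (- x).
by rewrite subrr Fnorm0 FnormN; lra.
Qed.

Section Rho.
Variables (V : nat -> set X) (n : nat).
Hypothesis hsub : submod_closed [in V n].

Lemma subspace0 : V n 0.
Proof. by case: hsub => /set_mem. Qed.

Lemma subspaceP a x y : V n x -> V n y -> V n (a *: x + y).
Proof. by case: hsub => _ h Vx Vy; apply/set_mem/h; apply/mem_set. Qed.

Lemma subspaceZ a x : V n x -> V n (a *: x).
Proof. by move=> Vx; rewrite -[_ *: _]addr0; exact: subspaceP subspace0. Qed.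

Lemma subspaceD x y : V n x -> V n y -> V n (x + y).
Proof. by move=> Vx Vy; rewrite -[x]scale1r; exact: subspaceP. Qed.

Lemma subspaceN x : V n x -> V n (- x).
Proof. by rewrite -scaleN1r; exact: subspaceZ. Qed.

Lemma rho_le x v : V n v -> rho N V n x <= N (x - v).
Proof.
move=> Vv; apply: ge_inf; last by exists v.
by exists 0 => _ [w _ <-]; exact: Fnorm_ge0.
Qed.

Lemma rho_lt x r : rho N V n x < r -> exists2 v, V n v & N (x - v) < r.
Proof.
have ne : [set N (x - v) | v in V n] !=set0.
  by exists (N (x - 0)), 0 => //; exact: subspace0.
by move=> /(inf_lt ne)[_ [v Vv <-] vr]; exists v.
Qed.

Lemma le_rho x r : (forall v, V n v -> r <= N (x - v)) -> r <= rho N V n x.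
Proof.
move=> h; rewrite leNgt; apply/negP => /rho_lt[v Vv].
by rewrite ltNge h.
Qed.

Lemma rho0 : rho N V n 0 <= 0.
Proof. by have := rho_le 0 subspace0; rewrite subr0 Fnorm0. Qed.

Lemma rho_leD x y : rho N V n (x + y) <= rho N V n x + N y.
Proof.
rewrite -lerBlDr; apply: le_rho => v Vv; rewrite lerBlDr.
apply: le_trans (rho_le _ Vv) _.
by rewrite addrAC; exact: Fnorm_triangle.
Qed.

Lemma rho_addl v x : V n v -> rho N V n (v + x) = rho N V n x.
Proof.
have rle w y : V n w -> rho N V n (w + y) <= rho N V n y.
  move=> Vw; apply: le_rho => z Vz.
  apply: le_trans (rho_le _ (subspaceD Vw Vz)) _.
  by rewrite opprD addrACA subrr add0r.
move=> Vv; apply/eqP; rewrite eq_le rle//=.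
by have := rle (- v) (v + x) (subspaceN Vv); rewrite addKr.
Qed.

End Rho.

Section Chain.
Variable V : nat -> set X.
Hypothesis hsub : forall n, submod_closed [in V n].
Hypothesis hnested : forall n, V n `<=` V n.+1.

Lemma nested_subset m n : (m <= n)%N -> V m `<=` V n.
Proof.
elim: n => [|n IH]; first by rewrite leqn0 => /eqP->.
rewrite leq_eqVlt => /predU1P[->//|/IH mn].
exact: subset_trans (hnested (n := n)).
Qed.

Lemma rho_nonincreasing m n x :
  (m <= n)%N -> rho N V n x <= rho N V m x.
Proof.
move=> mn; apply: le_rho (hsub m) _ _ _ => v Vv.
exact/rho_le/(nested_subset mn).
Qed.

Lemma subspace_sum n p (q : nat -> X) :
  (forall i, (i < p)%N -> V n (q i)) -> V n (\sum_(0 <= i < p) q i).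
Proof.
elim: p => [|p IH] h; first by rewrite big_geq//; exact: subspace0.
rewrite big_nat_recr//=; apply: subspaceD => //; last exact: h.
by apply: IH => i /ltnW ip; exact: h.
Qed.

(** A discrete intermediate value theorem along the multiples [u], [2 u], ...:
    consecutive distances to [V m] differ by at most [N u], so one of them falls
    between [b] and [2 * b].  Subtracting from that multiple an element of
    [V m] which almost realises its distance preserves the distance and makes
    the norm comparable to it. *)
Lemma spread_vector_of_multiple m b u p :
  0 < b -> V m.+1 u -> N u <= b -> b < rho N V m (p%:R *: u) ->
  exists q, [/\ V m.+1 q, b <= rho N V m q & N q <= 3 * b].
Proof.
move=> b0 Vu ub bp.
have ex : exists j, b <= rho N V m (j%:R *: u) by exists p; exact: ltW.
case: (ex_minnP ex) => -[|j] bj jmin.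
  by have := rho0 (hsub m); rewrite -(scale0r u); lra.
have jb : rho N V m (j%:R *: u) < b.
  by rewrite ltNge; apply/negP => /jmin; rewrite ltnn.
have j2b : rho N V m (j.+1%:R *: u) < 3 * b.
  have := rho_leD (hsub m) (j%:R *: u) u.
  by rewrite -{2}[u]scale1r -scalerDl natr1; lra.
have [w Vw wb] := rho_lt (hsub m) j2b.
exists (- w + j.+1%:R *: u); split.
- apply: subspaceD => //; last exact: subspaceZ.
  by apply: subspaceN => //; exact: hnested.
- by rewrite rho_addl//; exact: subspaceN.
- by rewrite addrC ltW.
Qed.

(** The terms [q i] with [i < k] lie in [V m] and do not affect the distance
    to it, so the [k]-th term dominates as soon as the tail is small. *)
Lemma rho_lacunary_series m k p (q : nat -> X) x b c :
  (k < p)%N -> (forall i, (i < k)%N -> V m (q i)) ->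
  b <= rho N V m (q k) -> N (\sum_(k.+1 <= i < p) q i) <= c ->
  b - c <= rho N V m x + N (\sum_(0 <= i < p) q i - x).
Proof.
move=> kp qV bq tc.
have := rho_leD (hsub m) x (\sum_(0 <= i < p) q i - x).
rewrite addrC subrK; apply: le_trans.
rewrite (big_cat_nat (n := k))//=; last exact: ltnW.
rewrite rho_addl//; last exact: subspace_sum.
rewrite big_ltn//.
have := rho_leD (hsub m) (q k + \sum_(k.+1 <= i < p) q i)
                (- \sum_(k.+1 <= i < p) q i).
by rewrite addrK FnormN; lra.
Qed.

End Chain.

(** The bound telescopes because [3 = 7 / 2 * (1 - 1 / 7)]. *)
Lemma Fnorm_sum_geometric (q : nat -> X) a m p :
  0 <= a -> (forall i, N (q i) <= 3 * (a / 7 ^+ i)) -> (m <= p)%N ->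
  N (\sum_(m <= i < p) q i) <= 7 / 2 * (a / 7 ^+ m).
Proof.
move=> a0 hq mp.
suff : N (\sum_(m <= i < p) q i) <= 7 / 2 * (a / 7 ^+ m - a / 7 ^+ p).
  move/le_trans; apply; rewrite ler_pM2l; last by lra.
  by rewrite gerBl divr_ge0// exprn_ge0.
elim: p mp => [|p IH].
  by rewrite leqn0 => /eqP->; rewrite big_geq// Fnorm0 subrr mulr0.
rewrite leq_eqVlt => /predU1P[->|mp].
  by rewrite big_geq// Fnorm0 subrr mulr0.
rewrite big_nat_recr//=.
apply: le_trans (Fnorm_triangle hN _ _) _.
by have := IH mp; have := hq p; rewrite exprS invfM; lra.
Qed.

End FNorm.

(** * Small multiples of a vector *)

(** A positive complex number is a positive real, so both scalar fields inherit
    this from the archimedean property of [R]. *)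
Lemma scalar_harmonic_cvg0 (R : realType) (k : scalar_kind) :
  (fun i => i.+1%:R^-1 : (scalar_field R k)^o) @ \oo --> 0.
Proof.
apply/cvgrPdist_lt; case: k => /= [r r0|[r s]].
  by have /cvgrPdist_lt/(_ r r0) := @cvg_harmonic R.
rewrite ltcE/= => /andP[/eqP-> r0]; near=> i.
rewrite sub0r normrN ger0_norm ?invr_ge0//.
have -> : (i.+1%:R^-1 : complex R) = real_complex R i.+1%:R^-1.
  by rewrite fmorphV rmorph_nat.
rewrite ltcR.
near: i; exact: (near_infty_natSinv_lt (PosNum r0)).
Unshelve. all: by end_near. Qed.

(** Subadditivity bounds the F-norm of a multiple of [v] from above, but only
    continuity of scalar multiplication makes the F-norms of its fractions
    small. *)
Lemma exists_small_fraction (R : realType) (K : numFieldType)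
    (X : topologicalLmodType K) (N : X -> R) (hX : frechet N)
    (K0 : (fun i => i.+1%:R^-1 : K^o) @ \oo --> 0) (v : X) (r : R) :
  0 < r -> exists p : nat, N (p.+1%:R^-1 *: v) <= r.
Proof.
move=> r0.
have : (i.+1%:R^-1 : K) *: v @[i --> \oo] --> (0 : X).
  rewrite -(scale0r v).
  apply: (cvg_comp (fun i => (i.+1%:R^-1 : K^o, v))
    (fun z : K^o * X => z.1 *: z.2) _ (@scale_continuous K X ((0 : K^o), v))).
  by apply: (cvg_pair K0 (cvg_cst v)).
move=> /(_ [set y | N (y - 0) < r]) [|p _ hp].
  by rewrite (frechet_nbhs hX); exists r.
by exists p; rewrite ltW//; have := hp p (leqnn p); rewrite /= subr0.
Qed.

(** * Vectors whose norm and distance are comparable *)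

(** The threshold [a] serves all the subspaces at once: this is what allows the
    sizes of the terms of a series to be fixed before the subspaces in which
    the terms are chosen. *)
Lemma subspaces_have_spread_vectors (R : realType) (k : scalar_kind)
    (X : topologicalLmodType (scalar_field R k)) (N : X -> R)
    (hX : frechet N) (V : nat -> set X)
    (hsub : forall n, submod_closed [in V n])
    (hnested : forall n, V n `<=` V n.+1) (hd : (0 < dV N V)%E) :
  exists2 a : R, 0 < a & forall m b, 0 < b -> b <= a ->
    exists q, [/\ V m.+1 q, b <= rho N V m q & N q <= 3 * b].
Proof.
have [a a0 ad] : exists2 a : R, 0 < a & (a%:E < dV N V)%E.
  case: (dV N V) hd => [r| |]//.
  - by rewrite lte_fin => r0; exists (r / 2); rewrite ?lte_fin; lra.
  - by exists 1 => //; exact: ltry.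
exists a => // m b b0 ba.
have : (a%:E < dn N V m)%E.
  by apply: lt_le_trans ad _; apply: ereal_inf_lbound; exists m.
move=> /ereal_sup_gt[_ [v Vv <-]]; rewrite lte_fin => av.
have [p vb] := exists_small_fraction hX (@scalar_harmonic_cvg0 R k) v b0.
apply: (spread_vector_of_multiple (frechet_Fnorm hX) hsub hnested
          (u := p.+1%:R^-1 *: v) (p := p.+1)) => //.
- exact: subspaceZ.
- by rewrite scalerA divff ?pnatr_eq0// scale1r; exact: le_lt_trans av.
Qed.

(** * Lacunary indices *)

Lemma exists_lacunary_thresholds (P : nat -> nat -> Prop) :
  (forall k, \forall n \near \oo, P k n) ->
  exists2 t : nat -> nat, (forall k, (t k < t k.+1)%N) &
    forall k n, (t k <= n)%N -> P k n.
Proof.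
move=> hP.
have /choice[g gP] : forall k, exists g, forall n, (g <= n)%N -> P k n.
  by move=> k; have [g _ h] := hP k; exists g.
(* The successors make the partial sums strictly increasing. *)
exists (fun k => \sum_(i < k.+1) (g i).+1)%N => [k|k n].
  by rewrite [ltnRHS]big_ord_recr/= addnS ltnS leq_addr.
by rewrite big_ord_recr/= addnS => /ltnW h; apply: gP;
  apply: leq_trans h; exact: leq_addl.
Qed.

Lemma lacunary_bracket (t : nat -> nat) n :
  (forall k, (t k < t k.+1)%N) -> (t 0 <= n)%N ->
  exists k, (t k <= n < t k.+1)%N.
Proof.
move=> tS t0n.
have tk k : (k <= t k)%N by elim: k => // k IH; exact: leq_ltn_trans (tS k).
have ex : exists k, (t k <= n)%N by exists 0%N.
have bd k : (t k <= n)%N -> (k <= n)%N by exact: leq_trans.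
case: (ex_maxnP ex bd) => k kn kmax; exists k; rewrite kn ltnNge.
by apply/negP => /kmax; rewrite ltnn.
Qed.

(** * Vectors with slowly decreasing distances *)

Theorem theorem2p12 (R : realType) (k : scalar_kind)
    (X : topologicalLmodType (scalar_field R k)) (N : X -> R)
    (hX : frechet N) (hdim : infinite_dimensional X)
    (V : nat -> set X)
    (hsub : forall n : nat, submod_closed [in V n])
    (hnested : forall n : nat, V n `<=` V n.+1)
    (hclosure : forall n : nat, closure (V n) `<=` V n.+1)
    (hdense : closure (\bigcup_n V n) = [set: X])
    (e : nat -> R)
    (he_pos : forall n : nat, 0 < e n)
    (he_decr : nonincreasing_seq e)
    (he_lim : e @ \oo --> (0 : R))
    (hd : (0 < dV N V)%E) :
  exists (x : X) (n0 : nat), forall n : nat, (n0 <= n)%N -> e n <= rho N V n x.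
Proof.
have hN := frechet_Fnorm hX.
have [a a0 spread] := subspaces_have_spread_vectors hX hsub hnested hd.
pose b i := a / 7 ^+ i.
have b0 i : 0 < b i by rewrite divr_gt0// exprn_gt0.
have ba i : b i <= a.
  by rewrite ler_pdivrMr ?exprn_gt0// ler_peMr ?exprn_ege1 ?(ltW a0)// ler1n.
have bS i : b i = 7 * b i.+1 by rewrite /b exprS invfM; lra.
have [t tS te] : exists2 t : nat -> nat, (forall i, (t i < t i.+1)%N) &
    forall i n, (t i <= n)%N -> e n <= b i / 2.
  apply: exists_lacunary_thresholds => i.
  have h : 0 < b i / 2 by rewrite divr_gt0.
  by move/cvgrPdist_le : he_lim => /(_ _ h); apply: filterS => n /=;
    rewrite sub0r normrN ger0_norm// ltW.
(* The terms are spread at the last index before the next threshold, because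
   [rho] decreases with the index: a bound there covers the whole block. *)
have /choice[q qP] := fun i => spread (t i.+1).-1 (b i) (b0 i) (ba i).
have tpos i : (t i.+1).-1.+1 = t i.+1.
  by rewrite prednK// (leq_ltn_trans _ (tS i)).
have qN i : N (q i) <= 3 * (a / 7 ^+ i) by have [] := qP i.
have tail m p : (m <= p)%N -> N (\sum_(m <= i < p) q i) <= 7 / 2 * b m.
  exact: (Fnorm_sum_geometric hN (ltW a0) qN).
have earlier i j : (i < j)%N -> V (t j.+1).-1 (q i).
  move=> ij; have [Vq _ _] := qP i; move: Vq; rewrite tpos.
  apply: (nested_subset hnested); rewrite -ltnS tpos.
  by rewrite (homo_ltn ltn_trans).
have bcvg : b @ \oo --> 0.
  have g0 : geometric a (7^-1 : R) @ \oo --> 0.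
    by apply: cvg_geometric; rewrite ger0_norm; lra.
  by apply: cvg_trans g0; apply: near_eq_cvg; apply: nearW => i;
    rewrite /= exprVn.
have [x xP] : exists x : X, (fun p => \sum_(0 <= i < p) q i) @ \oo --> x.
  apply: (frechet_complete hX) => r r0.
  have h : 0 < r / (7 / 2) by lra.
  have [p0 _ hp0] := (cvgrPdist_lt _ _).1 bcvg _ h.
  have tail_lt m p : (p0 <= m)%N -> (m <= p)%N ->
      N (\sum_(0 <= i < p) q i - \sum_(0 <= i < m) q i) < r.
    move=> p0m mp; rewrite (big_cat_nat _ mp)//= addrAC subrr add0r.
    apply: le_lt_trans (tail _ _ mp) _; rewrite mulrC -ltr_pdivlMr; last by lra.
    by have := hp0 m p0m; rewrite /= sub0r normrN ger0_norm// ltW.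
  exists p0 => m p p0m p0p; case: (leqP m p) => [mp|/ltnW pm].
    by rewrite (FnormB hN); exact: tail_lt.
  exact: tail_lt.
exists x, (t 0%N) => n /(lacunary_bracket tS)[j /andP[tjn ntj]].
apply: le_trans (te _ _ tjn) _.
have nj : (n <= (t j.+1).-1)%N by rewrite -ltnS tpos.
apply: le_trans (rho_nonincreasing hN hsub hnested x nj).
apply/ler_addgt0Pr => r r0.
have /xP[p0 _ hp0] : nbhs x [set y | N (y - x) < r].
  by rewrite (frechet_nbhs hX); exists r.
pose p := maxn p0 j.+1.
have [_ bq _] := qP j.
have := rho_lacunary_series hN hsub x (leq_maxr p0 j.+1 : (j < p)%N)
  (fun i => @earlier i j) bq (tail _ _ (leq_maxr _ _)).
(* The tail is at most [7 / 2 * b j.+1 = b j / 2]. *)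
have := hp0 p (leq_maxl _ _); rewrite /= [b j]bS.
by lra.
Qed.
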